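(* Let $n,k,t$ be positive integers with $t$ dividing $2nk$, and suppose that there exists an integer $\mathrm{H}_t(n;k)$. (1) If $t$ divides $nk$, then $nk\equiv 0\pmod 4$ or $nk\equiv -t\equiv \pm1\pmod 4$. (2) If $t=2nk$, then $k$ must be even. (3) If $t\neq 2nk$ and $t$ does not divide $nk$, then $t+2nk\equiv 0\pmod 8$.
   Context: A partially filled (p.f.) $m\times n$ array is an $m\times n$ matrix in which some cells are allowed to be empty. Let $n,k,t$ be positive integers such that $t$ divides $2nk$, let $v=2nk+t$, and let $J$ be the subgroup of $\mathbb{Z}_v$ of order $t$. An $\mathrm{H}_t(n;k)$ (square Heffter array over $\mathbb{Z}_v$ relative to $J$) is an $n\times n$ p.f. array with elements in $\mathbb{Z}_v$ such that: each row and each column contains exactly $k$ filled cells; for every $x\in\mathbb{Z}_v\setminus J$, either $x$ or $-x$ appears in the array; the elements in every row and every column sum to $0$ in $\mathbb{Z}_v$. It is called integer if the elements in every row and every column, viewed as integers in $\pm\{1,\ldots,\lfloor\frac{2nk+t}{2}\rfloor\}$, sum to zero in $\mathbb{Z}$. *)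

(* Defs.v *)
From HB Require Import structures.
From mathcomp Require Import all_boot all_order all_algebra all_fingroup.

Set Implicit Arguments.
Unset Strict Implicit.
Unset Printing Implicit Defensive.

Import GRing.Theory Num.Theory.
Local Open Scope ring_scope.

Definition pf_array (T : Type) (m n : nat) := 'M[option T]_(m, n).

Section PartiallyFilled.
Variables (T : eqType) (m n : nat) (A : pf_array T m n).

Definition row_filled (i : 'I_m) : nat := #|[set j | A i j != None]|.

Definition col_filled (j : 'I_n) : nat := #|[set i | A i j != None]|.

Definition appears (x : T) : bool := [exists i, exists j, A i j == Some x].

(* Sums of the images under f of the filled cells of a line; an empty cell
   contributes 0. *)
Definition row_sum (V : zmodType) (f : T -> V) (i : 'I_m) : V :=
  \sum_j oapp f 0 (A i j).

Definition col_sum (V : zmodType) (f : T -> V) (j : 'I_n) : V :=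
  \sum_i oapp f 0 (A i j).

End PartiallyFilled.

Definition heffter_mod (n k t : nat) : nat := (2 * n * k + t)%N.

(* {group 'Z_v} is the type of subgroups of the additive group of 'Z_v.
   The condition #|J| = t is a hypothesis wherever J is introduced.
   The disjunction is inclusive: there are 2nk elements outside J, none of them
   equal to its opposite, and only nk filled cells, so each pair {x, -x}
   outside J is met exactly once and no element of J appears. *)
Definition is_heffter (n k t : nat) (J : {group 'Z_(heffter_mod n k t)})
    (A : pf_array 'Z_(heffter_mod n k t) n n) : Prop :=
  [/\ forall i, row_filled A i = k,
      forall j, col_filled A j = k,
      forall x, x \notin J -> appears A x \/ appears A (- x),
      forall i, row_sum A id i = 0 &
      forall j, col_sum A id j = 0].

(* The representative in {1, ..., floor(v/2)} or its negative. The values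
   at 0 and (v even) at v/2, where such a representative is missing or not
   unique, are irrelevant: both lie in J, hence do not appear in the array. *)
Definition signed_rep (v : nat) (x : 'Z_v) : int :=
  if (x <= v %/ 2)%N then (x : nat)%:Z else (x : nat)%:Z - v%:Z.

Definition is_integer_heffter (n k t : nat)
    (J : {group 'Z_(heffter_mod n k t)})
    (A : pf_array 'Z_(heffter_mod n k t) n n) : Prop :=
  [/\ is_heffter J A,
      forall i, row_sum A (@signed_rep (heffter_mod n k t)) i = 0 &
      forall j, col_sum A (@signed_rep (heffter_mod n k t)) j = 0].

(* Main.v *)
(** The elements of Z_v outside J are 2nk in number and only nk cells are
    filled, so the entries are distinct and form a half-system: they and their
    opposites partition the complement of J.  Put |x| = min(x, v - x); this is
    invariant under negation and has the parity of the signed representative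
    of x.  Since the signed entries add up to 0, the sum of |x| over the entries
    is even, so its sum over the complement of J, which is twice as large, is
    divisible by 4.  With J = dZ_v, d = v/t, and the sum of |x| over Z_v equal
    to floor(v/2) ceil(v/2), this reads
      floor(v/2) ceil(v/2) = d floor(t/2) ceil(t/2)   (mod 4),
    and (1) and (3) follow by separating the parities of d and t.  For (2),
    d = 2 and all entries are odd, so a row of k of them can only add up to 0
    if k is even. *)

Require Import Defs.
From HB Require Import structures.
From mathcomp Require Import all_boot all_order all_algebra all_fingroup.
From mathcomp Require Import cyclic zify.

Set Implicit Arguments.
Unset Strict Implicit.
Unset Printing Implicit Defensive.

Import GRing.Theory Num.Theory.
Local Open Scope ring_scope.

(** Counting: |S ∪ h(S)| <= 2|S| <= |U| <= |S ∪ h(S)|, so equality holds throughout. *)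
Lemma half_system (T : finType) (h : T -> T) (S U : {set T}) :
    U \subset S :|: h @: S -> (#|S|.*2 <= #|U|)%N ->
  [/\ U = S :|: h @: S, [disjoint S & h @: S] & #|S|.*2 = #|U| ].
Proof.
move=> sUS leSU; have leh : (#|h @: S| <= #|S|)%N by apply: leq_imset_card.
have cUI := cardsUI S (h @: S); have leU := subset_leq_card sUS.
have [cU cI] : #|S :|: h @: S| = #|U| /\ #|S :&: h @: S| = 0%N by split; lia.
split=> //; last by lia.
  by apply/eqP; rewrite eqEcard sUS cU leqnn.
by rewrite -setI_eq0 -cards_eq0 cI.
Qed.

(** Induction in steps of two: in the sum for v + 2 the end terms are 0 and 1, and each of the v
    middle terms is one more than a term of the sum for v. *)
Lemma sum_minn (v : nat) :
  (\sum_(x < v) minn x (v - x))%N = (v./2 * uphalf v)%N.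
Proof.
have [m] := ubnP v; elim: m v => // m IHm [|[|v]] lt_vm.
- by rewrite big_ord0.
- by rewrite big_ord1 min0n.
rewrite big_ord_recl min0n add0n big_ord_recr /=.
rewrite (eq_bigr (fun x : 'I_v => 1 + minn x (v - x)))%N; last first.
  by move=> x _; have := ltn_ord x; rewrite /= /bump /=; lia.
rewrite big_split /= sum1_card card_ord IHm; last by lia.
rewrite /bump /= uphalf_half; have := odd_double_half v; nia.
Qed.

Lemma half_sum_odd_mod4 (q t m : nat) (v := (q.*2.+1 * t)%N) :
    (v./2 * uphalf v = q.*2.+1 * (t./2 * uphalf t) + m * 4)%N ->
  if odd t then (q * q.+1 = 0 %[mod 4])%N else (q * t = 0 %[mod 4])%N.
Proof.
rewrite {}/v; have := odd_double_half t; set s := t./2.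
case: (odd t) => tE.
  have -> : uphalf t = s.+1 by lia.
  have [-> ->] : (q.*2.+1 * t)./2 = (2 * s * q + s + q)%N /\
    uphalf (q.*2.+1 * t) = (2 * s * q + s + q).+1 by nia.
  have /dvdnP[w wE] : (2 %| s * s.+1)%N by rewrite dvdn2 oddM /=; case: odd.
  (* [E] simplifies to q(q+1) + 2q(2q+1)s(s+1) = 4m; as s(s+1) is even, the second term vanishes mod
     4. *)
  move=> E; have : (q * q.+1 + 4 * (w * q * q.*2.+1) = m * 4)%N.
    have E1 : (q * q.+1 + 2 * (s * s.+1) * q * q.*2.+1 = m * 4)%N by lia.
    by rewrite wE in E1; lia.
  by lia.
have -> : uphalf t = s by lia.
have [-> ->] : (q.*2.+1 * t)./2 = (q.*2.+1 * s)%N /\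
  uphalf (q.*2.+1 * t) = (q.*2.+1 * s)%N by nia.
move=> E; have E2 : (q.*2.+1 * (q * (s * s)) = m * 2)%N by lia.
have /dvdnP[w wE] : (2 %| q * s)%N.
  have := congr1 odd E2; rewrite dvdn2 !oddM /= odd_double.
  by case: (odd q); case: (odd s); rewrite ?andbF.
by rewrite -tE; lia.
Qed.

(** With t = 2s the equation halves to 2(cs)^2 = cs^2 + 2m, so cs is even and 2ct = 4cs is divisible
    by 8. *)
Lemma half_sum_even_mod8 (c t m : nat) (v := (c.*2 * t)%N) :
    ~~ odd t ->
    (v./2 * uphalf v = c.*2 * (t./2 * uphalf t) + m * 4)%N ->
  (c.*2 * t = 0 %[mod 8])%N.
Proof.
move=> even_t; have := odd_double_half t; rewrite {}/v (negPf even_t).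
set s := t./2 => tE.
have -> : uphalf t = s by lia.
have [-> ->] : (c.*2 * t)./2 = (c.*2 * s)%N /\
  uphalf (c.*2 * t) = (c.*2 * s)%N by nia.
move=> E; have E2 : (c * s * s + m * 2 = 2 * (c * s * c * s))%N by lia.
have /dvdnP[w wE] : (2 %| c * s)%N.
  have := congr1 odd E2; rewrite dvdn2 !(oddD, oddM) /=.
  by case: (odd c); case: (odd s); rewrite ?andbF.
by rewrite -tE; lia.
Qed.

(** Parities are read in ['F_2], where signed integers and natural numbers can be compared and
    summed alike. *)
Lemma natr_F2_eq0 (m : nat) : (m%:R == 0 :> 'F_2) = ~~ odd m.
Proof. by rewrite -(@dvdn_pcharf _ 2) ?pchar_Fp // dvdn2. Qed.

Lemma ltn_Zp (v : nat) (x : 'Z_v) : (1 < v)%N -> (x < v)%N.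
Proof. by move=> v_gt1; rewrite -[X in (_ < X)%N](Zp_cast v_gt1). Qed.

Lemma val_oppZp (v : nat) (x : 'Z_v) : (1 < v)%N ->
  (- x)%R = ((v - x) %% v)%N :> nat.
Proof. by move/Zp_cast=> vE; congr ((_ - _) %% _)%N. Qed.

(** * The subgroup of order t as the multiples of d *)

Section SubgroupZp.
Variables (v d t : nat) (J : {group 'Z_v}).
Hypotheses (v_gt1 : (1 < v)%N) (vE : v = (d * t)%N) (cardJ : #|J| = t).

Lemma dvdn_mem_subgroup (x : 'Z_v) : x \in J -> (d %| x)%N.
Proof.
move=> Jx; have t_gt0 : (0 < t)%N by lia.
have : (x ^+ t)%g = 1%g by rewrite -cardJ; exact: expg_cardG.
rewrite FinRing.zmodXgE Zp_mulrn => /(congr1 val) /= /eqP.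
rewrite -/(dvdn _ _) [X in (X %| _)%N]Zp_cast // [X in (X %| _)%N]vE.
by rewrite dvdn_pmul2r.
Qed.

Let mulz (j : 'I_t) : 'Z_v := inZp (d * j).

Lemma val_mulz (j : 'I_t) : mulz j = (d * j)%N :> nat.
Proof.
by rewrite /= Zp_cast // modn_small // vE ltn_pmul2l //; lia.
Qed.

Lemma mulz_inj : injective mulz.
Proof.
move=> i j /(congr1 (@nat_of_ord _)) /eqP.
rewrite !val_mulz eqn_pmul2l; last by lia.
by move/eqP/val_inj.
Qed.

Lemma dvdn_mulz (x : 'Z_v) : (d %| x)%N -> x \in mulz @: 'I_t.
Proof.
case/dvdnP=> q xE; have lt_qt : (q < t)%N.
  by have := ltn_Zp x v_gt1; rewrite xE; nia.
apply/imsetP; exists (Ordinal lt_qt) => //.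
by apply/ord_inj; rewrite val_mulz xE mulnC.
Qed.

Lemma subgroupE : J = mulz @: 'I_t :> {set 'Z_v}.
Proof.
apply/eqP; rewrite eqEcard card_imset; last exact: mulz_inj.
rewrite card_ord cardJ leqnn andbT; apply/subsetP => x Jx.
exact/dvdn_mulz/dvdn_mem_subgroup.
Qed.

Lemma mem_subgroup (x : 'Z_v) : (x \in J) = (d %| x)%N.
Proof.
apply/idP/idP; first exact: dvdn_mem_subgroup.
by move/dvdn_mulz; rewrite -subgroupE.
Qed.

(** On J, min(dj, dt - dj) = d min(j, t - j), so J contributes d times the full sum for t. *)
Lemma sum_minn_setC :
  (v./2 * uphalf v = d * (t./2 * uphalf t) +
     \sum_(x in ~: J) minn x (v - x))%N.
Proof.
rewrite -!sum_minn -[in LHS](big_mkord xpredT (fun x => minn x (v - x))).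
rewrite -{1}(Zp_cast v_gt1) big_mkord (bigID (mem J)) /=; congr (_ + _)%N.
  rewrite subgroupE big_imset /=; last by move=> i j _ _; apply: mulz_inj.
  rewrite big_distrr; apply: eq_bigr => j _.
  by have /= -> := val_mulz j; rewrite {1}vE -mulnBr -minnMr.
by apply: eq_big => // x; rewrite in_setC.
Qed.

End SubgroupZp.

(** * The entries of the array and their parities *)

Section Array.
Variables (v n k : nat) (J : {group 'Z_v}) (A : pf_array 'Z_v n n).
Hypothesis v_gt1 : (1 < v)%N.
Hypothesis cardJC : #|~: J| = (2 * n * k)%N.
Hypothesis rowA : forall i, row_filled A i = k.
Hypothesis appA : forall x, x \notin J -> appears A x \/ appears A (- x).
Hypothesis sumA : forall i, row_sum A (@signed_rep v) i = 0.

Let cells := [set p : 'I_n * 'I_n | A p.1 p.2 != None].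
Let entry (p : 'I_n * 'I_n) : 'Z_v := odflt 0 (A p.1 p.2).
Let entries := entry @: cells.

Lemma sum_cells (V : nmodType) (F : 'I_n * 'I_n -> V) :
  \sum_(p in cells) F p = \sum_i \sum_(j | A i j != None) F (i, j).
Proof.
by rewrite pair_big_dep; apply: eq_big => -[i j] //; rewrite inE.
Qed.

Lemma card_cells : #|cells| = (n * k)%N.
Proof.
rewrite -sum1_card (sum_cells (fun=> 1%N)) -[in RHS](card_ord n) -sum_nat_const.
by apply: eq_bigr => i _; rewrite sum1dep_card -(rowA i).
Qed.

Lemma mem_entries (i j : 'I_n) (x : 'Z_v) : A i j = Some x -> x \in entries.
Proof.
move=> Aij; apply/imsetP; exists (i, j); first by rewrite inE /= Aij.
by rewrite /entry /= Aij.
Qed.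

(** There are at most nk distinct entries, and [half_system] with negation forces exactly nk, hence
    no repetition among the cells. *)
Lemma entries_half_system :
  [/\ ~: J = entries :|: (fun x => - x) @: entries,
      [disjoint entries & (fun x => - x) @: entries]
    & {in cells &, injective entry}].
Proof.
have leS : (#|entries| <= n * k)%N by rewrite -card_cells leq_imset_card.
have sJ : ~: J \subset entries :|: (fun x => - x) @: entries.
  apply/subsetP => x; rewrite !inE => /appA[] /existsP[i /existsP[j /eqP]].
    by move/mem_entries->.
  move/mem_entries=> Sx; apply/orP; right; apply/imsetP.
  by exists (- x); rewrite ?opprK.
have [|JE disj cS] := half_system sJ.
  by rewrite cardJC -mulnA mul2n leq_double.
split=> //; apply/imset_injP; rewrite card_cells -/entries.
by apply/eqP/double_inj; rewrite cS cardJC -mulnA mul2n.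
Qed.

Lemma signed_rep_mod2 (x : 'Z_v) :
  (signed_rep x)%:~R = (minn x (v - x))%:R :> 'F_2.
Proof.
have lt_xv : (x < v)%N by apply: ltn_Zp.
have F2N (a : 'F_2) : - a = a by case: a => [[|[|[]]]] // ?; apply/val_inj.
rewrite /signed_rep; case: leqP => le_x.
  by rewrite (minn_idPl _) //; lia.
rewrite (minn_idPr _); last by lia.
by rewrite -[LHS]F2N -mulrNz opprB pmulrn -subzn // ltnW.
Qed.

Lemma dvd4_sum_minn : (4 %| \sum_(x in ~: J) minn x (v - x))%N.
Proof.
have [-> disj inj_entry] := entries_half_system.
rewrite (eq_bigl [in [predU entries & (fun x => - x) @: entries]]); last first.
  by move=> x; rewrite !inE.
rewrite bigU //= [X in (_ + X)%N]big_imset /=; last first.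
  by move=> x y _ _; apply: oppr_inj.
rewrite [X in (_ + X)%N](eq_bigr (fun x : 'Z_v => minn x (v - x))); last first.
  move=> x _; have lt_xv : (x < v)%N by apply: ltn_Zp.
  have /= -> := val_oppZp x v_gt1.
  (* At x = 0 the representative of -x is 0, not v - x. *)
  have [->|x_gt0] := posnP x; first by rewrite subn0 modnn !min0n.
  by rewrite modn_small; lia.
rewrite addnn -muln2 (@dvdn_pmul2r 2 2) // dvdn2 -natr_F2_eq0 natr_sum.
rewrite (eq_bigr (fun x => (signed_rep x)%:~R)); last first.
  by move=> x _; rewrite signed_rep_mod2.
(* Injectivity of [entry] turns the sum over entries into one over cells, grouped by rows. *)
rewrite -(rmorph_sum (intmul 1)) /= big_imset //= sum_cells.
rewrite big1 // => i _; rewrite -[RHS](sumA i) big_mkcond.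
apply: eq_bigr => j _.
by rewrite /entry /=; case: (A i j).
Qed.

(** Each filled cell of the row contributes 1 in ['F_2], so k is congruent to the row sum 0. *)
Lemma even_row_filled (i0 : 'I_n) :
  ~~ odd v -> (forall x, x \notin J -> odd (x : 'Z_v)) -> ~~ odd k.
Proof.
move=> even_v oddJC; rewrite -natr_F2_eq0 -(rowA i0) /row_filled -sum1_card.
rewrite natr_sum big_mkcond /=.
have /(congr1 (intmul (1 : 'F_2))) := sumA i0.
rewrite rmorph_sum /= => sum0; rewrite -[X in _ == X]sum0.
apply/eqP/eq_bigr => j _; rewrite inE.
case Aij: (A i0 j) => [x|] //=.
have /oddJC odd_x : x \notin J.
  have [JE _ _] := entries_half_system.
  by rewrite -in_setC JE inE (mem_entries Aij).
have lt_xv : (x < v)%N by apply: ltn_Zp.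
apply/eqP; rewrite signed_rep_mod2 eq_sym -subr_eq0.
have m_gt0 : (0 < minn x (v - x))%N by lia.
by rewrite -(natrB _ m_gt0) natr_F2_eq0; lia.
Qed.

End Array.

Theorem proposition3p1 (n k t : nat)
  (n_gt0 : (0 < n)%N) (k_gt0 : (0 < k)%N) (t_gt0 : (0 < t)%N)
  (t_dvd : (t %| 2 * n * k)%N)
  (J : {group 'Z_(heffter_mod n k t)}) (cardJ : #|J| = t)
  (exA : exists A : pf_array 'Z_(heffter_mod n k t) n n,
           is_integer_heffter J A) :
  [/\ (t %| n * k)%N ->
        ((n * k)%N%:Z = 0 %[mod 4])%Z \/
        ((n * k)%N%:Z = - t%:Z %[mod 4])%Z /\
          ((- t%:Z = 1 %[mod 4])%Z \/ (- t%:Z = - 1 %[mod 4])%Z),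
      t = (2 * n * k)%N -> ~~ odd k &
      t <> (2 * n * k)%N -> ~~ (t %| n * k)%N ->
        (t + 2 * n * k = 0 %[mod 8])%N].
Proof.
have [A [[rowA _ appA _ _] sumA _]] := exA.
have /dvdnP[r rE] := t_dvd; pose d := r.+1.
have vE : heffter_mod n k t = (d * t)%N by rewrite /heffter_mod rE /d; lia.
have v_gt1 : (1 < heffter_mod n k t)%N by rewrite /heffter_mod; nia.
have cardJC : #|~: J| = (2 * n * k)%N.
  by have := cardsC J; rewrite cardJ card_ord Zp_cast // /heffter_mod; lia.
have := sum_minn_setC v_gt1 vE cardJ.
have /dvdnP[m ->] := dvd4_sum_minn v_gt1 cardJC rowA appA sumA.
rewrite vE => sumE.
split.
(* Here nk = qt and d = 2q + 1. *)
- case/dvdnP => q qE; have rE2 : r = q.*2 by nia.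
  move: sumE; rewrite /d rE2 => /half_sum_odd_mod4; rewrite qE.
  case: ifP => [odd_t qq|_ qt]; last by left; lia.
  (* 4 divides q(q+1), and only one factor is even; q = 3 mod 4 gives nk = -t mod 4. *)
  have [a [->|->]] : exists a, (q = a * 4 \/ q = a * 4 + 3)%N.
  + exists (q %/ 4)%N; have := ltn_pmod q (isT : 0 < 4)%N.
    move: (divn_eq q 4) qq.
    by move: (q %/ 4)%N (q %% 4)%N => b [|[|[|[|]]]] //=; lia.
  + by left; lia.
  by right; lia.
- move=> tE; have rE1 : r = 1%N by nia.
  apply: (even_row_filled v_gt1 cardJC rowA appA sumA (Ordinal n_gt0)).
    by rewrite vE /d rE1 oddM.
  by move=> x; rewrite (mem_subgroup v_gt1 vE cardJ) /d rE1 dvdn2 negbK.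
(* If r were even, halving 2nk = rt would give t | nk; so d = r + 1 is even, and rt = 2nk makes t
   even. *)
move=> _ ndvd; have odd_r : odd r.
  apply: contraNT ndvd => even_r; apply/dvdnP; exists r./2.
  have := odd_double_half r; rewrite (negPf even_r); nia.
have dE : d = (r./2.+1).*2 by rewrite /d; lia.
have even_t : ~~ odd t.
  have := congr1 odd rE.
  by rewrite -mulnA mul2n odd_double oddM odd_r => /esym/negbT.
have -> : (t + 2 * n * k = (r./2.+1).*2 * t)%N by rewrite -dE rE /d; lia.
by apply: half_sum_even_mod8 even_t _; rewrite -dE; apply: sumE.
Qed.
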